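(* Let $M$ be a parallelizable smooth manifold of dimension $m$, $n\ge 1$, $A=C^\infty(M)\otimes M_n(\mathbb{C})$, and let $A^1=\mathrm{Hom}_{Z(A)}(\mathrm{Der}A,A)$ with its basis $\{\theta^i\}_{1\le i\le m+n^2-1}$ and the flip automorphism $\sigma$ of $A^1\otimes_A A^1$ (see context). Let $\nabla^L$ be a left connection and $\nabla^R$ a right connection on $A^1$, with Christoffel symbols $\Gamma^i_{jk},\widetilde\Gamma^i_{jk}\in A$ defined by $$\nabla^L\theta^i=\theta^j\otimes_A\theta^k\,\Gamma^i_{jk},\qquad \nabla^R\theta^i=\theta^j\otimes_A\theta^k\,\widetilde\Gamma^i_{jk}.$$ Then: (1) the pair $(\nabla^L,\nabla^R)$ is $\sigma$-compatible (i.e. $\nabla^L\zeta=(\sigma\circ\nabla^R)\zeta$ for all $\zeta$ in the centre $Z(A^1)$) if and only if $\widetilde\Gamma^i_{kj}=\Gamma^i_{jk}$ for all $i,j,k$; (2) the pair $(\nabla^L,\nabla^R)$ is $\sigma$-compatible on the whole bimodule (i.e. $\nabla^L\zeta=(\sigma\circ\nabla^R)\zeta$ for all $\zeta\in A^1$) if and only if $\widetilde\Gamma^i_{kj}=\Gamma^i_{jk}\in C^\infty(M)$ for all $i,j,k$.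
   Context: Summation over repeated indices is understood. The ground field is $\mathbb{C}$, $C^\infty(M)$ consists of complex-valued functions and is identified with $C^\infty(M)\otimes 1=Z(A)$. $A^1=\mathrm{Hom}_{Z(A)}(\mathrm{Der}A,A)$ is an $A$-bimodule via $(a\alpha b)(X)=a\,\alpha(X)\,b$, with differential $d:A\to A^1$, $(da)(X)=X(a)$. Since $M$ is parallelizable, $\mathrm{Der}A$ is a free $Z(A)$-module with a basis $\{e_i\}_{1\le i\le m+n^2-1}$ ($m$ elements from a global frame of vector fields on $M$, and $n^2-1$ inner derivations from a basis of traceless matrices), and $\{\theta^i\}$ is the dual basis, $\theta^i(e_j)=\delta^i_j1$. It is a basis of $A^1$ both as a left and as a right $A$-module, and $a\theta^i=\theta^ia$ for all $a\in A$. $\sigma:A^1\otimes_AA^1\to A^1\otimes_AA^1$ is the bimodule automorphism interchanging arguments in $\mathrm{Der}A$; it is the bimodule automorphism satisfying $\sigma(\theta^i\otimes_A\theta^j)=\theta^j\otimes_A\theta^i$. A left connection on $A^1$ is a linear map $\nabla^L:A^1\to A^1\otimes_AA^1$ with $\nabla^L(a\zeta)=da\otimes_A\zeta+a\nabla^L\zeta$; a right connection is a linear map $\nabla^R:A^1\to A^1\otimes_AA^1$ with $\nabla^R(\zeta a)=(\nabla^R\zeta)a+\zeta\otimes_Ada$ (for all $a\in A$, $\zeta\in A^1$). The centre of the bimodule is $Z(A^1)=\{\zeta\in A^1: a\zeta=\zeta a\ \ \forall a\in A\}$. *)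

(* Defs.v *)
From HB Require Import structures.
From mathcomp Require Import all_boot all_order all_algebra.
From mathcomp Require Import all_classical all_reals all_analysis.
From mathcomp Require Import complex generic_quotient.

Set Implicit Arguments.
Unset Strict Implicit.
Unset Printing Implicit Defensive.

Import Order.TTheory GRing.Theory Num.Theory.
Import numFieldNormedType.Exports.

Local Open Scope classical_set_scope.
Local Open Scope ring_scope.
Local Open Scope complex_scope.

Local Notation Re := complex.Re.
Local Notation Im := complex.Im.

Section Ck.
Variables (R : realType) (m : nat).
Implicit Types (U : set 'rV[R]_m) (f g : 'rV[R]_m -> R).

(* [Ck k U f] : all partial derivatives of [f] of order at most [k] exist and
   are continuous at every point of the open set [U]; values off [U] are
   irrelevant. *)
Fixpoint Ck (k : nat) U f : Prop :=
  (forall x, U x -> {for x, continuous f}) /\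
  (if k is k'.+1 then
     forall i : 'I_m, (forall x, U x -> derivable f x (delta_mx 0 i)) /\
                      Ck k' U (fun x => 'D_(delta_mx 0 i) f x)
   else True).

Definition Cinfty U f : Prop := forall k, Ck k U f.

Lemma CkS k U f : Ck k.+1 U f -> Ck k U f.
Proof.
elim: k f => [|k IH] f [fc fd]; split => // i.
by have [fd1 fd2] := fd i; split => //; exact: IH.
Qed.

Lemma Ck_ext k U f g : open U -> (forall x, U x -> f x = g x) ->
  Ck k U f -> Ck k U g.
Proof.
move=> oU; elim: k f g => [|k IH] f g fg.
  move=> [fc _]; split => // x Ux.
  have nfg : {near x, f =1 g} by apply: filterS (open_nbhs_nbhs (conj oU Ux)).
  change (g @ x --> g x); rewrite -(fg _ Ux).
  exact: cvg_trans (near_eq_cvg nfg) (fc x Ux).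
move=> [fc fd].
have E i x : U x ->
    (fun h => h^-1 *: ((f \o shift x) (h *: delta_mx 0 i) - f x)) @ 0^' =
    (fun h => h^-1 *: ((g \o shift x) (h *: delta_mx 0 i) - g x)) @ 0^'.
  move=> Ux.
  have H : \forall h \near (0:R)^',
      h^-1 *: ((f \o shift x) (h *: delta_mx 0 i) - f x) =
      h^-1 *: ((g \o shift x) (h *: delta_mx 0 i) - g x).
    have c0 : (fun h : R => h *: (delta_mx 0 i : 'rV[R]_m) + x) @ (0:R) --> x.
      have {2}-> : x = (0 : R) *: (delta_mx 0 i : 'rV[R]_m) + x.
        by rewrite scale0r add0r.
      apply: cvgD; last exact: cvg_cst.
      by apply: cvgZr_tmp; exact: cvg_id.
    have := c0 _ (open_nbhs_nbhs (conj oU Ux)) => /nbhs_dnbhs.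
    by apply: filterS => h /= /fg ->; rewrite fg.
  apply/seteqP; split => A; apply: near_eq_cvg => //.
  by apply: filterS H => h ->.
split.
  move=> x Ux.
  have nfg : {near x, f =1 g} by apply: filterS (open_nbhs_nbhs (conj oU Ux)).
  change (g @ x --> g x); rewrite -(fg _ Ux).
  exact: cvg_trans (near_eq_cvg nfg) (fc x Ux).
move=> i; have [fd1 fd2] := fd i; split.
  by move=> x Ux; rewrite /derivable -E //; exact: fd1.
by apply: IH fd2 => x Ux; rewrite /derive E.
Qed.

Lemma Ck_cst k U (r : R) : Ck k U (cst r).
Proof.
elim: k r => [|k IH] r; split => //; try by move=> x _; exact: cst_continuous.
move=> i; split; first by move=> x _; exact: derivable_cst.
have -> : (fun x : 'rV[R]_m => 'D_(delta_mx 0 i) (cst r) x) = cst (0 : R).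
  by apply: funext => x; rewrite derive_cst.
exact: IH.
Qed.

Lemma CkB k U f g : open U -> Ck k U f -> Ck k U g -> Ck k U (f - g).
Proof.
move=> oU; elim: k f g => [|k IH] f g [fc fd] [gc gd]; split => //;
  try by move=> x Ux; apply: continuousB; [exact: fc|exact: gc].
move=> i; have [fd1 fd2] := fd i; have [gd1 gd2] := gd i; split.
  by move=> x Ux; apply: derivableB; [exact: fd1|exact: gd1].
apply: (Ck_ext oU _ (IH _ _ fd2 gd2)) => x Ux.
by rewrite deriveB //; [exact: fd1|exact: gd1].
Qed.

Lemma CkD k U f g : open U -> Ck k U f -> Ck k U g -> Ck k U (f + g).
Proof.
move=> oU Cf Cg; rewrite -[g]opprK -[- g]sub0r.
by apply: CkB => //; apply: CkB => //; exact: Ck_cst.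
Qed.

Lemma CkM k U f g : open U -> Ck k U f -> Ck k U g -> Ck k U (f * g).
Proof.
move=> oU; elim: k f g => [|k IH] f g Cf Cg.
  case: Cf Cg => fc _ [gc _]; split => // x Ux.
  by apply: continuousM; [exact: fc|exact: gc].
have Cf' := CkS Cf; have Cg' := CkS Cg.
case: Cf Cg => fc fd [gc gd]; split.
  by move=> x Ux; apply: continuousM; [exact: fc|exact: gc].
move=> i; have [fd1 fd2] := fd i; have [gd1 gd2] := gd i; split.
  by move=> x Ux; apply: derivableM; [exact: fd1|exact: gd1].
apply: (Ck_ext oU _ (CkD oU (IH _ _ Cf' gd2) (IH _ _ Cg' fd2))) => x Ux.
by rewrite deriveM //; [exact: fd1|exact: gd1].
Qed.

End Ck.

Record chart (R : realType) (m : nat) (M : topologicalType) := Chart {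
  chart_dom : set M;
  chart_map :> M -> 'rV[R]_m;
  chart_inv : 'rV[R]_m -> M;
  chart_dom_open : open chart_dom;
  chart_cod_open : open (chart_map @` chart_dom);
  chart_mapK : forall p, chart_dom p -> chart_inv (chart_map p) = p;
  chart_continuous : forall p, chart_dom p -> {for p, continuous chart_map};
  chart_inv_continuous : forall x, (chart_map @` chart_dom) x ->
    {for x, continuous chart_inv} }.

(* A smooth structure is given by an atlas, not necessarily maximal. *)
Record smoothManifold (R : realType) (m : nat) := SmoothManifold {
  mcarrier :> topologicalType;
  mhausdorff : hausdorff_space mcarrier;
  msecond_countable : @second_countable mcarrier;
  atlas : set (chart R m mcarrier);
  atlas_cover : forall p, exists2 c, atlas c & chart_dom c p;
  atlas_compatible : forall c c', atlas c -> atlas c' -> forall i : 'I_m,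
    Cinfty (c @` (chart_dom c `&` chart_dom c'))
           (fun x => c' (chart_inv c x) 0 i) }.

Definition smooth (R : realType) (m : nat) (M : smoothManifold R m)
    (f : M -> R) : Prop :=
  forall c, atlas c -> Cinfty (c @` chart_dom c) (f \o chart_inv c).

Section SmoothFunctions.
Variables (R : realType) (m : nat) (M : smoothManifold R m).

Lemma smooth_cst (r : R) : smooth (cst r : M -> R).
Proof. by move=> c _ k; exact: Ck_cst. Qed.

Lemma smoothB (f g : M -> R) : smooth f -> smooth g -> smooth (f - g).
Proof.
by move=> sf sg c ac k; apply: CkB; [exact: chart_cod_open|exact: sf|exact: sg].
Qed.

Lemma smoothD (f g : M -> R) : smooth f -> smooth g -> smooth (f + g).
Proof.
by move=> sf sg c ac k; apply: CkD; [exact: chart_cod_open|exact: sf|exact: sg].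
Qed.

Lemma smoothM (f g : M -> R) : smooth f -> smooth g -> smooth (f * g).
Proof.
by move=> sf sg c ac k; apply: CkM; [exact: chart_cod_open|exact: sf|exact: sg].
Qed.

Definition rsmooth_pred : {pred M -> R} := fun f => `[< smooth f >].

Lemma rsmooth_subring : subring_closed rsmooth_pred.
Proof.
split.
- by apply/asboolP; exact: smooth_cst.
- by move=> f g /asboolP sf /asboolP sg; apply/asboolP; exact: smoothB.
- by move=> f g /asboolP sf /asboolP sg; apply/asboolP; exact: smoothM.
Qed.

Record rsmoothFun := RSmoothFun {
  rsmooth_fun :> M -> R; _ : rsmooth_fun \in rsmooth_pred }.
HB.instance Definition _ := [isSub for rsmooth_fun].
HB.instance Definition _ := [Choice of rsmoothFun by <:].
HB.instance Definition _ :=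
  GRing.SubChoice_isSubComPzRing.Build _ _ rsmoothFun rsmooth_subring.

Definition csmooth_pred : {pred M -> R[i]} :=
  fun f => `[< smooth (fun p => Re (f p)) /\ smooth (fun p => Im (f p)) >].

Lemma csmooth_subring : subring_closed csmooth_pred.
Proof.
have ReB (z w : R[i]) : Re (z - w) = Re z - Re w by case: z w => [? ?] [].
have ImB (z w : R[i]) : Im (z - w) = Im z - Im w by case: z w => [? ?] [].
have ReM (z w : R[i]) : Re (z * w) = Re z * Re w - Im z * Im w.
  by case: z w => [? ?] [].
have ImM (z w : R[i]) : Im (z * w) = Re z * Im w + Im z * Re w.
  by case: z w => [? ?] [].
split.
- by apply/asboolP; split; exact: smooth_cst.
- move=> f g /asboolP[fr fi] /asboolP[gr gi]; apply/asboolP; split.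
    rewrite (_ : (fun p => _) = (fun p => Re (f p)) - (fun p => Re (g p))).
      exact: smoothB.
    by apply/funext => p; exact: ReB.
  rewrite (_ : (fun p => _) = (fun p => Im (f p)) - (fun p => Im (g p))).
    exact: smoothB.
  by apply/funext => p; exact: ImB.
- move=> f g /asboolP[fr fi] /asboolP[gr gi]; apply/asboolP; split.
    rewrite (_ : (fun p => _) =
        (fun p => Re (f p)) * (fun p => Re (g p)) -
        (fun p => Im (f p)) * (fun p => Im (g p))).
      by apply: smoothB; exact: smoothM.
    by apply/funext => p; exact: ReM.
  rewrite (_ : (fun p => _) =
      (fun p => Re (f p)) * (fun p => Im (g p)) +
      (fun p => Im (f p)) * (fun p => Re (g p))).
    by apply: smoothD; exact: smoothM.
  by apply/funext => p; exact: ImM.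
Qed.

Record csmoothFun := CSmoothFun {
  csmooth_fun :> M -> R[i]; _ : csmooth_fun \in csmooth_pred }.
HB.instance Definition _ := [isSub for csmooth_fun].
HB.instance Definition _ := [Choice of csmoothFun by <:].
HB.instance Definition _ :=
  GRing.SubChoice_isSubComPzRing.Build _ _ csmoothFun csmooth_subring.

Definition rsmooth_cst (r : R) : rsmoothFun :=
  RSmoothFun (introT (asboolP _) (smooth_cst r)).

Lemma csmooth_subproof (u v : rsmoothFun) :
  (fun p => u p +i* v p : R[i]) \in csmooth_pred.
Proof.
by apply/asboolP; case: u v => [u su] [v sv]; split; exact/asboolP.
Qed.
Definition csmooth_of (u v : rsmoothFun) : csmoothFun :=
  CSmoothFun (csmooth_subproof u v).

Definition csmooth_cst (c : R[i]) : csmoothFun :=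
  csmooth_of (rsmooth_cst (Re c)) (rsmooth_cst (Im c)).

Lemma csmooth_Re_subproof (f : csmoothFun) :
  (fun p => Re (f p)) \in rsmooth_pred.
Proof. by apply/asboolP; case: f => f sf /=; have [] := asboolW sf. Qed.
Definition csmooth_Re (f : csmoothFun) : rsmoothFun :=
  RSmoothFun (csmooth_Re_subproof f).

Lemma csmooth_Im_subproof (f : csmoothFun) :
  (fun p => Im (f p)) \in rsmooth_pred.
Proof. by apply/asboolP; case: f => f sf /=; have [] := asboolW sf. Qed.
Definition csmooth_Im (f : csmoothFun) : rsmoothFun :=
  RSmoothFun (csmooth_Im_subproof f).

End SmoothFunctions.
Arguments rsmooth_cst {R m} M r.
Arguments csmooth_cst {R m} M c.

Section Tangent.
Variables (R : realType) (m : nat) (M : smoothManifold R m).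
Local Notation rsm := (rsmoothFun M).

(* T_pM : the derivations at p of the algebra of real smooth functions *)
Definition tangent_vector (p : M) (v : rsm -> R) : Prop :=
  (forall (r : R) (f g : rsm),
     v (rsmooth_cst M r * f + g) = r * v f + v g) /\
  (forall f g : rsm, v (f * g) = v f * g p + f p * v g).

(* real smooth vector fields, as derivations of the algebra of real smooth
   functions *)
Record vector_field := VectorField {
  vf_fun :> rsm -> rsm;
  vf_linear : forall (r : R) (f g : rsm),
    vf_fun (rsmooth_cst M r * f + g) = rsmooth_cst M r * vf_fun f + vf_fun g;
  vf_leibniz : forall f g : rsm,
    vf_fun (f * g) = vf_fun f * g + f * vf_fun g }.

(* The values of the X_i at every point p oneform a basis of T_pM; M is
   parallelizable when such a family exists. *)
Definition global_frame (X : 'I_m -> vector_field) : Prop :=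
  forall p : M,
    (forall c : 'I_m -> R,
       (forall f : rsm, \sum_i c i * X i f p = 0) -> forall i, c i = 0) /\
    (forall v : rsm -> R, tangent_vector p v ->
       exists c : 'I_m -> R, forall f : rsm, v f = \sum_i c i * X i f p).

(* C-linear extension: X (u + i v) = X u + i X v *)
Definition vf_complex (X : vector_field) (f : csmoothFun M) : csmoothFun M :=
  csmooth_of (X (csmooth_Re f)) (X (csmooth_Im f)).

End Tangent.

Section VfComplex.
Variables (R : realType) (m : nat) (M : smoothManifold R m).
Variable X : vector_field M.

Lemma csmoothP (f g : csmoothFun M) :
  (forall p, Re (f p) = Re (g p)) -> (forall p, Im (f p) = Im (g p)) -> f = g.
Proof.
move=> hr hi; apply: val_inj; apply/funext => p /=.
by move: (hr p) (hi p); case: (f p) (g p) => [a b] [c d] /= -> ->.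
Qed.

Lemma vf_additive (f g : rsmoothFun M) : X (f + g) = X f + X g.
Proof.
have c1 : rsmooth_cst M 1 = 1 by apply: val_inj.
by have := vf_linear X 1 f g; rewrite c1 !mul1r.
Qed.

Lemma vf_scale r (f : rsmoothFun M) :
  X (rsmooth_cst M r * f) = rsmooth_cst M r * X f.
Proof.
have X0 : X 0 = 0 by apply: (addIr (X 0)); rewrite -vf_additive !add0r.
by have := vf_linear X r f 0; rewrite X0 !addr0.
Qed.

Lemma vf_opp (f : rsmoothFun M) : X (- f) = - X f.
Proof.
apply: (addIr (X f)); rewrite -vf_additive !addNr.
by apply: (addIr (X 0)); rewrite -vf_additive !add0r.
Qed.

Lemma csmooth_ReD (f g : csmoothFun M) :
  csmooth_Re (f + g) = csmooth_Re f + csmooth_Re g.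
Proof.
apply: val_inj; apply/funext => p; rewrite /= /GRing.add /=.
by rewrite /GRing.add /=; case: (f p) (g p) => [? ?] [].
Qed.

Lemma csmooth_ImD (f g : csmoothFun M) :
  csmooth_Im (f + g) = csmooth_Im f + csmooth_Im g.
Proof.
apply: val_inj; apply/funext => p; rewrite /= /GRing.add /=.
by rewrite /GRing.add /=; case: (f p) (g p) => [? ?] [].
Qed.

Lemma csmooth_ReM (f g : csmoothFun M) :
  csmooth_Re (f * g) =
  csmooth_Re f * csmooth_Re g - csmooth_Im f * csmooth_Im g.
Proof.
apply: val_inj; apply/funext => p.
change (Re (f p * g p) = Re (f p) * Re (g p) - Im (f p) * Im (g p)).
by case: (f p) (g p) => [? ?] [].
Qed.

Lemma csmooth_ImM (f g : csmoothFun M) :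
  csmooth_Im (f * g) =
  csmooth_Re f * csmooth_Im g + csmooth_Im f * csmooth_Re g.
Proof.
apply: val_inj; apply/funext => p.
change (Im (f p * g p) = Re (f p) * Im (g p) + Im (f p) * Re (g p)).
by case: (f p) (g p) => [? ?] [].
Qed.

Lemma csmooth_eq (f g : csmoothFun M) :
  csmooth_Re f = csmooth_Re g -> csmooth_Im f = csmooth_Im g -> f = g.
Proof.
move=> hr hi; apply: csmoothP => p.
  exact: (congr1 (fun u : rsmoothFun M => u p) hr).
exact: (congr1 (fun u : rsmoothFun M => u p) hi).
Qed.

Lemma csmooth_Re_of (u v : rsmoothFun M) : csmooth_Re (csmooth_of u v) = u.
Proof. exact: val_inj. Qed.

Lemma csmooth_Im_of (u v : rsmoothFun M) : csmooth_Im (csmooth_of u v) = v.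
Proof. exact: val_inj. Qed.

Lemma vf_complexD (f g : csmoothFun M) :
  vf_complex X (f + g) = vf_complex X f + vf_complex X g.
Proof.
apply: csmooth_eq.
  by rewrite csmooth_ReD !csmooth_Re_of csmooth_ReD vf_additive.
by rewrite csmooth_ImD !csmooth_Im_of csmooth_ImD vf_additive.
Qed.

Lemma vf_complexZ c (f : csmoothFun M) :
  vf_complex X (csmooth_cst M c * f) = csmooth_cst M c * vf_complex X f.
Proof.
apply: csmooth_eq.
  rewrite csmooth_ReM !csmooth_Re_of !csmooth_Im_of csmooth_ReM.
  by rewrite !csmooth_Re_of !csmooth_Im_of vf_additive vf_opp !vf_scale.
rewrite csmooth_ImM !csmooth_Re_of !csmooth_Im_of csmooth_ImM.
by rewrite !csmooth_Re_of !csmooth_Im_of vf_additive !vf_scale.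
Qed.

Lemma vf_complexM (f g : csmoothFun M) :
  vf_complex X (f * g) = vf_complex X f * g + f * vf_complex X g.
Proof.
apply: csmooth_eq.
  rewrite csmooth_ReD !csmooth_ReM !csmooth_Re_of !csmooth_Im_of csmooth_ReM.
  by rewrite vf_additive vf_opp !vf_leibniz opprD addrACA.
rewrite csmooth_ImD !csmooth_ImM !csmooth_Re_of !csmooth_Im_of csmooth_ImM.
by rewrite vf_additive !vf_leibniz addrACA.
Qed.

Lemma vf_complex0 : vf_complex X 0 = 0.
Proof. by apply: (addIr (vf_complex X 0)); rewrite -vf_complexD !add0r. Qed.

End VfComplex.

(* C^oo(M) (x) M_n(C) is realised as the algebra of n x n matrices over
   C^oo(M); C^oo(M) acts on it by scaling and embeds in it as the scalar
   matrices [f%:M]. *)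
Notation matalg M n := 'M[csmoothFun M]_n.

Section Derivations.
Variables (R : realType) (m : nat) (M : smoothManifold R m) (n : nat).
Local Notation A := (matalg M n).

Definition der_pred : {pred A -> A} := fun D => `[<
  (forall (c : R[i]) (a b : A),
     D (csmooth_cst M c *: a + b) = csmooth_cst M c *: D a + D b) /\
  (forall a b : A, D (a * b) = D a * b + a * D b) >].

Lemma der_submod : submod_closed der_pred.
Proof.
split.
  apply/asboolP; split => [c a b|a b] /=.
    by rewrite /GRing.zero /= scaler0 addr0.
  by rewrite /GRing.zero /= mul0r mulr0 addr0.
move=> f D D' /asboolP[DZ DM] /asboolP[DZ' DM']; apply/asboolP.
have E a : (f *: D + D') a = f *: D a + D' a by [].
split => [c a b|a b]; rewrite !E.
  rewrite DZ DZ' !scalerDr !scalerA [f * _]mulrC -!addrA; congr (_ + _).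
  by rewrite addrCA.
rewrite DM DM' !mulrDl !mulrDr scalerDr.
rewrite -[_ *: D a * b]scalemxAl -[a * (_ *: _)]scalemxAr.
by rewrite -!addrA; congr (_ + _); rewrite addrCA.
Qed.

(* C-linear derivations of A, as a module over C^oo(M) = Z(A) *)
Record der := Der { der_fun :> A -> A; _ : der_fun \in der_pred }.
HB.instance Definition _ := [isSub for der_fun].
HB.instance Definition _ := [Choice of der by <:].
HB.instance Definition _ :=
  GRing.SubChoice_isSubLmodule.Build _ _ _ der der_submod.

Lemma vf_der_subproof (X : vector_field M) :
  (fun a : A => map_mx (vf_complex X) a) \in der_pred.
Proof.
apply/asboolP; split => [c a b|a b]; apply/matrixP => i j; rewrite !mxE.
  by rewrite vf_complexD vf_complexZ.
rewrite (big_morph _ (vf_complexD X) (vf_complex0 X)) -big_split /=.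
by apply: eq_bigr => k _; rewrite !mxE vf_complexM.
Qed.
(* a vector field, acting entrywise on matrices of functions *)
Definition vf_der (X : vector_field M) : der := Der (vf_der_subproof X).

(* M_n(C) inside A, as the constant matrices *)
Definition cst_mx (E : 'M[R[i]]_n) : A := map_mx (csmooth_cst M) E.

Lemma inner_der_subproof (E : 'M[R[i]]_n) :
  (fun a : A => cst_mx E * a - a * cst_mx E) \in der_pred.
Proof.
apply/asboolP; split => [c a b|a b].
  rewrite mulrDr mulrDl -[_ * (_ *: a)]scalemxAr -[(_ *: a) * _]scalemxAl.
  by rewrite scalerBr opprD addrACA.
rewrite mulrBl mulrBr !mulrA addrA.
by congr (_ - _); rewrite subrK.
Qed.
Definition inner_der (E : 'M[R[i]]_n) : der := Der (inner_der_subproof E).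

Definition traceless_basis (E : 'I_(n ^ 2 - 1) -> 'M[R[i]]_n) : Prop :=
  [/\ forall k, \tr (E k) = 0,
      forall c : 'I_(n ^ 2 - 1) -> R[i],
        \sum_k c k *: E k = 0 -> forall k, c k = 0
    & forall a : 'M[R[i]]_n, \tr a = 0 ->
        exists c : 'I_(n ^ 2 - 1) -> R[i], a = \sum_k c k *: E k].

(* e_1, ..., e_(m + n^2 - 1): the frame fields first, then the inner
   derivations *)
Definition der_frame (X : 'I_m -> vector_field M)
    (E : 'I_(n ^ 2 - 1) -> 'M[R[i]]_n) (j : 'I_(m + (n ^ 2 - 1))) : der :=
  match fintype.split j with inl k => vf_der (X k) | inr k => inner_der (E k) end.

End Derivations.

Section Forms.
Variables (R : realType) (m : nat) (M : smoothManifold R m) (n : nat).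
Local Notation A := (matalg M n).
Local Notation Der := (der M n).

Definition form_pred : {pred Der -> A} := fun alpha => `[<
  forall (f : csmoothFun M) (X Y : Der),
    alpha (f *: X + Y) = f *: alpha X + alpha Y >].

Lemma form_zmod : zmod_closed form_pred.
Proof.
split.
  by apply/asboolP => f X Y; rewrite /GRing.zero /= scaler0 addr0.
move=> al be /asboolP lal /asboolP lbe; apply/asboolP => f X Y.
have E Z : (al - be) Z = al Z - be Z by [].
by rewrite !E lal lbe scalerBr opprD addrACA.
Qed.

(* Z(A)-linearity is linearity over C^oo(M) = Z(A). *)
Record oneform := OneForm { form_fun :> Der -> A; _ : form_fun \in form_pred }.
HB.instance Definition _ := [isSub for form_fun].
HB.instance Definition _ := [Choice of oneform by <:].
HB.instance Definition _ :=
  GRing.SubChoice_isSubZmodule.Build _ _ oneform form_zmod.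

Lemma lactf_subproof (a : A) (alpha : oneform) :
  (fun X => a * alpha X) \in form_pred.
Proof.
case: alpha => al /= lal; apply/asboolP => f X Y; move/asboolW: lal => ->.
by rewrite mulrDr; congr (_ + _); exact/esym/scalemxAr.
Qed.
Definition lactf (a : A) (alpha : oneform) : oneform :=
  OneForm (lactf_subproof a alpha).

Lemma ractf_subproof (alpha : oneform) (a : A) :
  (fun X => alpha X * a) \in form_pred.
Proof.
case: alpha => al /= lal; apply/asboolP => f X Y; move/asboolW: lal => ->.
by rewrite mulrDl; congr (_ + _); exact/esym/scalemxAl.
Qed.
Definition ractf (alpha : oneform) (a : A) : oneform :=
  OneForm (ractf_subproof alpha a).

Lemma dform_subproof (a : A) : (fun X : Der => X a) \in form_pred.
Proof. by apply/asboolP. Qed.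
Definition dform (a : A) : oneform := OneForm (dform_subproof a).

(* membership in Z(A^1) *)
Definition central_form (zeta : oneform) : Prop :=
  forall a : A, lactf a zeta = ractf zeta a.

End Forms.

Section Tensor.
Variables (A : pzRingType) (U V : zmodType).
Variables (ractU : U -> A -> U) (lactV : A -> V -> V).

(* A list [:: (u1, v1); ...; (uk, vk)] stands for the formal sum of the
   u_i (x) v_i; [tens_rel] is the congruence generated by biadditivity and
   A-balancedness. Formal differences are not needed since the class of
   (- u, v) is opposite to that of (u, v). *)
Inductive tens_rel : seq (U * V) -> seq (U * V) -> Prop :=
| tens_refl s : tens_rel s s
| tens_sym s t : tens_rel s t -> tens_rel t s
| tens_trans s t r : tens_rel s t -> tens_rel t r -> tens_rel s r
| tens_cat s s' t t' : tens_rel s s' -> tens_rel t t' ->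
    tens_rel (s ++ t) (s' ++ t')
| tens_catC s t : tens_rel (s ++ t) (t ++ s)
| tens_0l v : tens_rel [:: (0, v)] [::]
| tens_Dl u u' v : tens_rel [:: (u + u', v)] [:: (u, v); (u', v)]
| tens_Dr u v v' : tens_rel [:: (u, v + v')] [:: (u, v); (u, v')]
| tens_bal u a v : tens_rel [:: (ractU u a, v)] [:: (u, lactV a v)].

Definition tens_relb : rel (seq (U * V)) := fun s t => `[< tens_rel s t >].

Lemma tens_relb_refl : reflexive tens_relb.
Proof. by move=> s; apply/asboolP; exact: tens_refl. Qed.
Lemma tens_relb_sym : symmetric tens_relb.
Proof. by move=> s t; apply/asboolP/asboolP; exact: tens_sym. Qed.
Lemma tens_relb_trans : transitive tens_relb.
Proof.
by move=> t s r /asboolP st /asboolP tr; apply/asboolP; exact: tens_trans tr.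
Qed.
Canonical tens_equiv :=
  EquivRel tens_relb tens_relb_refl tens_relb_sym tens_relb_trans.

Local Open Scope quotient_scope.

Definition tensor := {eq_quot tens_relb}.
HB.instance Definition _ := EqQuotient.on tensor.
HB.instance Definition _ := Choice.on tensor.

Definition tens_class (s : seq (U * V)) : tensor := \pi_tensor s.

Definition tens (u : U) (v : V) : tensor := tens_class [:: (u, v)].

Lemma tens_classP s t : tens_class s = tens_class t <-> tens_rel s t.
Proof.
split; first by move/eqmodP/asboolP.
by move=> st; apply/eqmodP/asboolP.
Qed.

Lemma tens_reprK (t : tensor) : tens_class (repr t) = t.
Proof. exact: reprK. Qed.

Lemma tens_repr_class s : tens_rel (repr (tens_class s)) s.
Proof. by apply/tens_classP; rewrite tens_reprK. Qed.

Definition tens_add (t t' : tensor) : tensor :=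
  tens_class (repr t ++ repr t').
Definition tens_opp (t : tensor) : tensor :=
  tens_class [seq (- p.1, p.2) | p <- repr t].

Lemma tens_addE s t :
  tens_add (tens_class s) (tens_class t) = tens_class (s ++ t).
Proof. by apply/tens_classP; apply: tens_cat; exact: tens_repr_class. Qed.

Lemma tens_addA : associative tens_add.
Proof.
move=> x y z; rewrite -(tens_reprK x) -(tens_reprK y) -(tens_reprK z).
by rewrite !tens_addE catA.
Qed.

Lemma tens_addC : commutative tens_add.
Proof. by move=> x y; apply/tens_classP; exact: tens_catC. Qed.

Lemma tens_add0 : left_id (tens_class [::]) tens_add.
Proof. by move=> x; rewrite -{1}(tens_reprK x) tens_addE cat0s tens_reprK. Qed.

Lemma tens_addN : left_inverse (tens_class [::]) tens_opp tens_add.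
Proof.
move=> x; rewrite -{2}(tens_reprK x) /tens_opp tens_addE.
apply/tens_classP; elim: (repr x) => [|[u v] s IH] /=; first exact: tens_refl.
set s' := [seq (- p.1, p.2) | p <- s] in IH *.
apply: (@tens_trans _ ([:: (- u, v); (u, v)] ++ (s' ++ s))).
  have -> : (- u, v) :: s' ++ (u, v) :: s =
      [:: (- u, v)] ++ ((s' ++ [:: (u, v)]) ++ s) by rewrite -catA.
  apply: (@tens_cat _ [:: (- u, v)] _ (([:: (u, v)] ++ s') ++ s)).
    exact: tens_refl.
  by apply: tens_cat; [exact: tens_catC | exact: tens_refl].
apply: (@tens_cat _ [::] _ [::]) => //.
apply: tens_trans (tens_0l v); apply: tens_sym.
by rewrite -(addNr u); exact: tens_Dl.
Qed.

HB.instance Definition _ :=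
  GRing.isZmodule.Build tensor tens_addA tens_addC tens_add0 tens_addN.

Lemma tens_class_sum s : tens_class s = \sum_(p <- s) tens p.1 p.2.
Proof.
elim: s => [|[u v] s IH]; first by rewrite big_nil.
by rewrite big_cons -IH; symmetry; exact: tens_addE.
Qed.

Lemma tensDl u u' v : tens (u + u') v = tens u v + tens u' v.
Proof.
rewrite [RHS]tens_addE; apply/tens_classP; exact: tens_Dl.
Qed.

Lemma tensDr u v v' : tens u (v + v') = tens u v + tens u v'.
Proof.
rewrite [RHS]tens_addE; apply/tens_classP; exact: tens_Dr.
Qed.

Lemma tens_balanced u a v : tens (ractU u a) v = tens u (lactV a v).
Proof. by apply/tens_classP; exact: tens_bal. Qed.

Section Lift.
Variables (W : zmodType) (h : U -> V -> W).
Hypothesis hDl : forall u u' v, h (u + u') v = h u v + h u' v.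
Hypothesis hDr : forall u v v', h u (v + v') = h u v + h u v'.
Hypothesis hbal : forall u a v, h (ractU u a) v = h u (lactV a v).

Lemma tens_rel_sum s t : tens_rel s t ->
  \sum_(p <- s) h p.1 p.2 = \sum_(p <- t) h p.1 p.2.
Proof.
elim => {s t} //.
- by move=> s t r _ -> _ ->.
- by move=> s s' t t' _ IH _ IH'; rewrite !big_cat /= IH IH'.
- by move=> s t; rewrite !big_cat /= addrC.
- move=> v; rewrite big_seq1 big_nil /=.
  by apply: (addIr (h 0 v)); rewrite -hDl !add0r.
- by move=> u u' v; rewrite !big_cons !big_nil /= !addr0 hDl.
- by move=> u v v'; rewrite !big_cons !big_nil /= !addr0 hDr.
- by move=> u a v; rewrite !big_seq1 hbal.
Qed.

Definition tens_lift (t : tensor) : W := \sum_(p <- repr t) h p.1 p.2.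

Lemma tens_liftE u v : tens_lift (tens u v) = h u v.
Proof.
by rewrite /tens_lift (tens_rel_sum (tens_repr_class _)) big_seq1.
Qed.

Lemma tens_liftD : {morph tens_lift : s t / s + t}.
Proof.
move=> s t; rewrite /tens_lift (tens_rel_sum (tens_repr_class _)).
by rewrite big_cat.
Qed.

End Lift.

End Tensor.

Section FormTensor.
Variables (R : realType) (m : nat) (M : smoothManifold R m) (n : nat).
Local Notation A := (matalg M n).
Local Notation Der := (der M n).
Local Notation A1 := (oneform M n).

Definition oneform2 := tensor (@ractf R m M n) (@lactf R m M n).
HB.instance Definition _ := GRing.Zmodule.on oneform2.

Definition ftens (alpha beta : A1) : oneform2 :=
  tens (@ractf R m M n) (@lactf R m M n) alpha beta.

Definition lact2 (a : A) : oneform2 -> oneform2 :=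
  tens_lift (fun alpha beta => ftens (lactf a alpha) beta).
Definition ract2 (t : oneform2) (a : A) : oneform2 :=
  tens_lift (fun alpha beta => ftens alpha (ractf beta a)) t.

(* the A-valued function on Der A x Der A given by an element of
   A^1 (x)_A A^1: the value of alpha (x) beta at (X, Y) is alpha(X) beta(Y) *)
Definition eval2 (t : oneform2) (X Y : Der) : A :=
  tens_lift (fun alpha beta : A1 => alpha X * beta Y) t.

Lemma formP (alpha beta : A1) : (forall X, alpha X = beta X) -> alpha = beta.
Proof. by move=> h; apply: val_inj; apply/funext. Qed.

Lemma lactfD a (alpha beta : A1) :
  lactf a (alpha + beta) = lactf a alpha + lactf a beta.
Proof. by apply: formP => X; exact: mulrDr. Qed.
Lemma ractfD (alpha beta : A1) a :
  ractf (alpha + beta) a = ractf alpha a + ractf beta a.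
Proof. by apply: formP => X; exact: mulrDl. Qed.
Lemma lractf a (alpha : A1) b :
  ractf (lactf a alpha) b = lactf a (ractf alpha b).
Proof. by apply: formP => X; exact/esym/mulrA. Qed.

Lemma lact2E a alpha beta :
  lact2 a (ftens alpha beta) = ftens (lactf a alpha) beta.
Proof.
apply: tens_liftE => [u u' v|u v v'|u b v].
- by rewrite lactfD; exact: tensDl.
- exact: tensDr.
- by rewrite -lractf; exact: tens_balanced.
Qed.

Lemma lact2D a : {morph lact2 a : s t / s + t}.
Proof.
apply: tens_liftD => [u u' v|u v v'|u b v].
- by rewrite lactfD; exact: tensDl.
- exact: tensDr.
- by rewrite -lractf; exact: tens_balanced.
Qed.

Lemma ract2E alpha beta a :
  ract2 (ftens alpha beta) a = ftens alpha (ractf beta a).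
Proof.
apply: (tens_liftE (h := fun u v => ftens u (ractf v a))) => [u u' v|u v v'|u b v].
- exact: tensDl.
- by rewrite ractfD; exact: tensDr.
- by rewrite lractf; exact: tens_balanced.
Qed.

Lemma ract2D a : {morph ract2^~ a : s t / s + t}.
Proof.
apply: tens_liftD => [u u' v|u v v'|u b v].
- exact: tensDl.
- by rewrite ractfD; exact: tensDr.
- by rewrite lractf; exact: tens_balanced.
Qed.

Lemma eval2E alpha beta X Y : eval2 (ftens alpha beta) X Y = alpha X * beta Y.
Proof.
apply: (tens_liftE (h := fun u v : A1 => u X * v Y)) => [u u' v|u v v'|u b v].
- exact: mulrDl.
- exact: mulrDr.
- exact/esym/mulrA.
Qed.

Lemma eval2D X Y : {morph (fun t => eval2 t X Y) : s t / s + t}.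
Proof.
apply: tens_liftD => [u u' v|u v v'|u b v].
- exact: mulrDl.
- exact: mulrDr.
- exact/esym/mulrA.
Qed.

Definition bimodule_automorphism (sigma : oneform2 -> oneform2) : Prop :=
  [/\ bijective sigma,
      {morph sigma : s t / s + t},
      forall a t, sigma (lact2 a t) = lact2 a (sigma t)
    & forall t a, sigma (ract2 t a) = ract2 (sigma t) a].

Definition is_flip (sigma : oneform2 -> oneform2) : Prop :=
  bimodule_automorphism sigma /\
  forall t X Y, eval2 (sigma t) X Y = eval2 t Y X.

Definition complex_linear (nabla : A1 -> oneform2) : Prop :=
  forall (c : R[i]) (zeta xi : A1),
    nabla (lactf (csmooth_cst M c)%:M zeta + xi) =
    lact2 (csmooth_cst M c)%:M (nabla zeta) + nabla xi.

Definition left_connection (nabla : A1 -> oneform2) : Prop :=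
  complex_linear nabla /\
  forall (a : A) (zeta : A1),
    nabla (lactf a zeta) = ftens (dform a) zeta + lact2 a (nabla zeta).

Definition right_connection (nabla : A1 -> oneform2) : Prop :=
  complex_linear nabla /\
  forall (zeta : A1) (a : A),
    nabla (ractf zeta a) = ract2 (nabla zeta) a + ftens zeta (dform a).

Definition sigma_compatible (sigma : oneform2 -> oneform2)
    (nablaL nablaR : A1 -> oneform2) : Prop :=
  forall zeta : A1, central_form zeta -> nablaL zeta = sigma (nablaR zeta).

Definition sigma_compatible_everywhere (sigma : oneform2 -> oneform2)
    (nablaL nablaR : A1 -> oneform2) : Prop :=
  forall zeta : A1, nablaL zeta = sigma (nablaR zeta).

Definition dual_family (N : nat) (e : 'I_N -> Der) (theta : 'I_N -> A1) : Prop :=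
  forall i j, theta i (e j) = (i == j)%:R.

(* C^oo(M), identified with C^oo(M) (x) 1 *)
Definition in_Cinfty (a : A) : Prop := exists f : csmoothFun M, a = f%:M.

End FormTensor.

(* Main.v *)
(* Every derivation of A is an inner derivation plus an entrywise derivation of
   C^oo(M), and Cramer's rule in the frame gives the latter smooth coefficients;
   so the e_j span Der A over Z(A), the theta^i commute with A, and an element
   of A^1 (x)_A A^1 is determined by its values on the pairs (e_j, e_k). Writing
   zeta = zeta_i theta^i = theta^i zeta_i, the two connections give
     (nabla^L zeta)(e_j, e_k) = e_j(zeta_k) + zeta_i Gamma^i_jk,
     (nabla^R zeta)(e_k, e_j) = e_j(zeta_k) + Gammat^i_kj zeta_i,
   so the derivative terms cancel and compatibility at zeta reads
   zeta_i Gamma^i_jk = Gammat^i_kj zeta_i. The choices zeta = theta^i and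
   zeta = a theta^i yield the two equivalences, as Z(A) = C^oo(M). *)
From HB Require Import structures.
Require Import Defs.
From mathcomp Require Import all_boot all_order all_algebra.
From mathcomp Require Import all_classical all_reals all_analysis.
From mathcomp Require Import complex.

Set Implicit Arguments.
Unset Strict Implicit.
Unset Printing Implicit Defensive.

Import Order.TTheory GRing.Theory Num.Theory.
Import numFieldNormedType.Exports.

Local Open Scope classical_set_scope.
Local Open Scope ring_scope.
Local Open Scope complex_scope.

(** * Locality of C^k and reciprocals *)

Section CkExtra.
Variables (R : realType) (m : nat).
Implicit Types (U V : set 'rV[R]_m) (f g : 'rV[R]_m -> R).

Lemma Ck_sub k U V f : U `<=` V -> Ck k V f -> Ck k U f.
Proof.
move=> UV; elim: k f => [|k IH] f [fc fd]; split => //;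
  try by move=> x /UV; exact: fc.
move=> i; have [fd1 fd2] := fd i; split; last exact: IH.
by move=> x /UV; exact: fd1.
Qed.

(** Continuity and derivability in [Ck] are conditions at single points of the ambient space, so [V]
    need neither be open nor lie in [U]. *)
Lemma Ck_local k U f :
  (forall x, U x -> exists2 V, V x & Ck k V f) -> Ck k U f.
Proof.
elim: k f => [|k IH] f loc; split => //.
- by move=> x /loc[V Vx [fc _]]; exact: fc.
- by move=> x /loc[V Vx [fc _]]; exact: fc.
move=> i; split.
  by move=> x /loc[V Vx [_ fd]]; have [fd1 _] := fd i; exact: fd1.
apply: IH => x /loc[V Vx [_ fd]]; exists V => //.
by have [_ fd2] := fd i.
Qed.

Lemma CkV k U f : open U -> (forall x, U x -> f x != 0) ->
  Ck k U f -> Ck k U (fun x => (f x)^-1).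
Proof.
move=> oU f0; elim: k => [|k IH] Cf.
  by case: Cf => fc _; split => // x Ux; apply: continuousV; [exact: f0|exact: fc].
have CV := IH (CkS Cf); case: (Cf) => fc fd; split.
  by move=> x Ux; apply: continuousV; [exact: f0|exact: fc].
move=> i; have [fd1 fd2] := fd i; split.
  by move=> x Ux; apply: derivableV; [exact: f0|exact: fd1].
(* The derivative -f'/f^2 is put in the form 0 - f^-1 f^-1 f', to which closure under products and
   differences applies. *)
have := CkB oU (Ck_cst k U 0) (CkM oU (CkM oU CV CV) fd2).
apply: Ck_ext => // x Ux; rewrite deriveV ?f0 //; last exact: fd1.
change (0 - (f x)^-1 * (f x)^-1 * 'D_(delta_mx 0 i) f x =
  - (f x) ^- 2 * 'D_(delta_mx 0 i) f x).
by rewrite sub0r mulNr expr2 invfM.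
Qed.

End CkExtra.

(** * Smooth coefficients of vector fields in a global frame *)

Section SmoothFields.
Variables (R : realType) (m : nat) (M : smoothManifold R m).
Local Notation rsm := (rsmoothFun M).

(** Near [p0] one has c = f/g with [g] nonvanishing, and smoothness is local. Cramer's rule produces
    this form, with a denominator controlled only at a chosen point. *)
Lemma smooth_local_quotient (c : M -> R) :
  (forall p0 : M, exists f g : rsm, g p0 != 0 /\ forall p, g p * c p = f p) ->
  smooth c.
Proof.
move=> loc ch ac k; apply: Ck_local => x0 Ux0.
have [f [g [g0 gE]]] := loc (chart_inv ch x0).
have sm k' (h : rsm) : Ck k' (ch @` chart_dom ch) (h \o chart_inv ch).
  by case: h => h /= /asboolP; exact.
pose U := ch @` chart_dom ch; pose V := U `&` [set x | g (chart_inv ch x) != 0].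
have oU : open U := @chart_cod_open _ _ _ ch.
have gc x : U x -> {for x, continuous (g \o chart_inv ch)}.
  by have [gc _] := sm 0%N g; exact: gc.
have oV : open V.
  rewrite openE => x [Ux gx]; rewrite /interior.
  apply: filterI; first exact: open_nbhs_nbhs.
  apply: (gc x Ux [set r | r != 0]); apply: open_nbhs_nbhs.
  split => //; exact: open_neq.
exists V; first by [].
have VU : V `<=` U by move=> x [].
have CgV : Ck k V (fun x => (g (chart_inv ch x))^-1).
  apply: CkV => //; first by move=> x [].
  exact: Ck_sub VU (sm k g).
apply: Ck_ext (CkM oV (Ck_sub VU (sm k f)) CgV) => // x [Ux gx].
change (f (chart_inv ch x) * (g (chart_inv ch x))^-1 = c (chart_inv ch x)).
by rewrite -gE [_ * c _]mulrC mulfK.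
Qed.

(** Named so that it can be declared a ring morphism: determinants and adjugates then pass to values
    at [p] through [map_mx]. *)
Definition rsmooth_eval (p : M) (f : rsm) : R := f p.

Lemma rsmooth_eval_zmod p : zmod_morphism (rsmooth_eval p).
Proof. by []. Qed.
Lemma rsmooth_eval_monoid p : monoid_morphism (rsmooth_eval p).
Proof. by []. Qed.
HB.instance Definition _ p :=
  GRing.isZmodMorphism.Build _ _ (rsmooth_eval p) (rsmooth_eval_zmod p).
HB.instance Definition _ p :=
  GRing.isMonoidMorphism.Build _ _ (rsmooth_eval p) (rsmooth_eval_monoid p).

Variables (X : 'I_m -> vector_field M) (X_frame : global_frame X).

Definition frame_jacobian (F : 'I_m -> rsm) : 'M[rsm]_m :=
  \matrix_(r, i) X i (F r).

(* Otherwise a nonzero covector would kill all rows (X_i f (p))_i,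
   contradicting the linear independence of the X_i at p. *)
Lemma frame_jacobian_unit (p : M) : exists F : 'I_m -> rsm,
  map_mx (rsmooth_eval p) (frame_jacobian F) \in unitmx.
Proof.
(* The functions are chosen one at a time, keeping the [k] rows independent at [p]. *)
have step k : (k <= m)%N -> exists F : 'I_k -> rsm,
    (k <= \rank (\matrix_(r < k, i < m) X i (F r) p))%N.
  elim: k => [|k IH] km; first by exists (fun=> 0).
  have [F rF] := IH (ltnW km); set B := \matrix_(r, i) _ in rF.
  (* Since the rank of [B] is at most k < m, some nonzero covector is orthogonal to all its rows. *)
  have : kermx B^T != 0.
    rewrite -mxrank_eq0 mxrank_ker mxrank_tr -lt0n subn_gt0.
    exact: leq_ltn_trans (rank_leq_row B) km.
  case/rowV0Pn => c /sub_kermxP cB c0.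
  have [f fc] : exists f : rsm, \sum_i c 0 i * X i f p != 0.
    apply: contrapT => /forallNP nf; move/eqP: c0; apply.
    apply/rowP => i; rewrite mxE; apply: (X_frame p).1 => f.
    by have /negP := nf f; rewrite negbK => /eqP.
  pose w : 'rV[R]_m := \row_i X i f p.
  (* Anything in the row space of [B] pairs to zero with [c], but the new row [w] does not; adding
     it raises the rank. *)
  have wB : ~~ (w <= B)%MS.
    apply: contra fc => /submxP[D wD]; apply/eqP.
    have : (c *m w^T) 0 0 = 0 by rewrite wD trmx_mul mulmxA cB mul0mx mxE.
    by rewrite mxE; under eq_bigr do rewrite !mxE.
  exists (fun r => if unlift ord0 r is Some r' then F r' else f).
  suff -> : \matrix_(r < k.+1, i < m)
      X i (if unlift ord0 r is Some r' then F r' else f) p = col_mx w B.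
    change (k < \rank (col_mx w B))%N.
    rewrite -addsmxE; apply: leq_ltn_trans rF _; apply: rank_ltmx.
    by rewrite /ltmx addsmxSr addsmx_sub submx_refl andbT.
  apply/matrixP => r i; rewrite mxE.
  case: (unliftP ord0 r) => [r' ->|->].
    transitivity (col_mx w B (rshift 1 r') i); first by rewrite col_mxEd mxE.
    by congr (col_mx w B _ _); exact: ord_inj.
  transitivity (col_mx w B (lshift k 0) i); first by rewrite col_mxEu mxE.
  by congr (col_mx w B _ _); exact: ord_inj.
have [F rF] := step m (leqnn m); exists F.
rewrite (_ : map_mx _ _ = \matrix_(r < m, i < m) X i (F r) p).
  by rewrite -row_full_unit /row_full eqn_leq rank_leq_row.
by apply/matrixP => r i; rewrite !mxE.
Qed.

(** The coefficients exist pointwise because the X_i(p) span T_pM. Writing y_r = Y(F_r) and [G] for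
    the Jacobian of [F], the identity det(G) c = adj(G) y exhibits them as local quotients of smooth
    functions. *)
Lemma vector_field_frame (Y : vector_field M) :
  exists c : 'I_m -> rsm, forall f, Y f = \sum_i c i * X i f.
Proof.
have tv p : tangent_vector p (fun f => Y f p).
  by split => [r f g|f g]; rewrite ?vf_linear ?vf_leibniz.
pose c i p := projT1 (cid ((X_frame p).2 _ (tv p))) i.
have cE p f : Y f p = \sum_i c i p * X i f p.
  by rewrite /c; case: cid => c' /= ->.
have sc i : smooth (c i).
  apply: smooth_local_quotient => p0.
  have [F Fu] := frame_jacobian_unit p0; set G := frame_jacobian F.
  pose y : 'cV[rsm]_m := \col_r Y (F r).
  exists ((\adj G *m y) i 0), (\det G); split.
    by move: Fu; rewrite unitmxE unitfE det_map_mx.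
  (* The identity is required at every [p], even where det(G) vanishes, hence the adjugate in place
     of the inverse. *)
  move=> p; pose cv : 'cV[R]_m := \col_i c i p.
  have yE : map_mx (rsmooth_eval p) y = map_mx (rsmooth_eval p) G *m cv.
    apply/colP => r; rewrite !mxE [LHS]cE.
    by apply: eq_bigr => k _; rewrite !mxE mulrC.
  have -> : (\adj G *m y) i 0 p = (map_mx (rsmooth_eval p) (\adj G *m y)) i 0.
    by rewrite [RHS]mxE.
  rewrite map_mxM yE mulmxA map_mx_adj mul_adj_mx det_map_mx.
  by rewrite mul_scalar_mx !mxE.
exists (fun i => RSmoothFun (introT (asboolP _) (sc i))) => f.
apply: val_inj; apply/funext => p; rewrite [LHS]cE.
by rewrite -[RHS]/(rsmooth_eval p _) raddf_sum.
Qed.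

End SmoothFields.

(** * Complex derivations of C^oo(M) *)

Section ComplexDerivations.
Variables (R : realType) (m : nat) (M : smoothManifold R m).
Local Notation rsm := (rsmoothFun M).
Local Notation csm := (csmoothFun M).

Lemma csmooth_cst_zmod : zmod_morphism (@csmooth_cst R m M).
Proof. by move=> [a b] [c d]; apply: csmoothP. Qed.
Lemma csmooth_cst_monoid : monoid_morphism (@csmooth_cst R m M).
Proof. by split => [|[a b] [c d]]; apply: csmoothP. Qed.
HB.instance Definition _ :=
  GRing.isZmodMorphism.Build _ _ (@csmooth_cst R m M) csmooth_cst_zmod.
HB.instance Definition _ :=
  GRing.isMonoidMorphism.Build _ _ (@csmooth_cst R m M) csmooth_cst_monoid.

Definition csmooth_real (u : rsm) : csm := csmooth_of u 0.

Lemma csmooth_real_zmod : zmod_morphism csmooth_real.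
Proof.
move=> u v; apply: csmoothP => // p.
by rewrite -[RHS]/(0 - 0) subr0.
Qed.
Lemma csmooth_real_monoid : monoid_morphism csmooth_real.
Proof.
split => [|u v]; apply: csmoothP => // p.
  by rewrite -[RHS]/(u p * v p - 0 * 0) mul0r subr0.
by rewrite -[RHS]/(u p * 0 + 0 * v p) mulr0 mul0r addr0.
Qed.
HB.instance Definition _ :=
  GRing.isZmodMorphism.Build _ _ csmooth_real csmooth_real_zmod.
HB.instance Definition _ :=
  GRing.isMonoidMorphism.Build _ _ csmooth_real csmooth_real_monoid.

Lemma csmooth_real_cst (r : R) :
  csmooth_real (rsmooth_cst M r) = csmooth_cst M r%:C.
Proof. exact: csmoothP. Qed.

Lemma csmooth_ofE (u v : rsm) :
  csmooth_of u v = csmooth_real u + csmooth_cst M 'i * csmooth_real v.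
Proof.
apply: csmoothP => p.
  by rewrite -[RHS]/(u p + (0 * v p - 1 * 0)) mul0r mulr0 subr0 addr0.
by rewrite -[RHS]/(0 + (0 * 0 + 1 * v p)) mul0r mul1r !add0r.
Qed.

Lemma csmooth_ReIm (f : csm) :
  f = csmooth_real (csmooth_Re f) +
      csmooth_cst M 'i * csmooth_real (csmooth_Im f).
Proof. by rewrite -csmooth_ofE; exact: csmoothP. Qed.

Lemma csmooth_Re_realM (u : rsm) (f : csm) :
  csmooth_Re (csmooth_real u * f) = u * csmooth_Re f.
Proof. by rewrite csmooth_ReM csmooth_Re_of csmooth_Im_of mul0r subr0. Qed.

Lemma csmooth_Im_realM (u : rsm) (f : csm) :
  csmooth_Im (csmooth_real u * f) = u * csmooth_Im f.
Proof. by rewrite csmooth_ImM csmooth_Re_of csmooth_Im_of mul0r addr0. Qed.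

Variables (d : csm -> csm).
Hypothesis d_linear : forall c f g,
  d (csmooth_cst M c * f + g) = csmooth_cst M c * d f + d g.
Hypothesis d_leibniz : forall f g, d (f * g) = d f * g + f * d g.

Lemma cderivation_Re_linear (r : R) (f g : rsm) :
  csmooth_Re (d (csmooth_real (rsmooth_cst M r * f + g))) =
  rsmooth_cst M r * csmooth_Re (d (csmooth_real f)) +
  csmooth_Re (d (csmooth_real g)).
Proof.
rewrite rmorphD rmorphM /= csmooth_real_cst d_linear csmooth_ReD.
by rewrite -csmooth_real_cst csmooth_Re_realM.
Qed.

Lemma cderivation_Im_linear (r : R) (f g : rsm) :
  csmooth_Im (d (csmooth_real (rsmooth_cst M r * f + g))) =
  rsmooth_cst M r * csmooth_Im (d (csmooth_real f)) +
  csmooth_Im (d (csmooth_real g)).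
Proof.
rewrite rmorphD rmorphM /= csmooth_real_cst d_linear csmooth_ImD.
by rewrite -csmooth_real_cst csmooth_Im_realM.
Qed.

Lemma cderivation_Re_leibniz (f g : rsm) :
  csmooth_Re (d (csmooth_real (f * g))) =
  csmooth_Re (d (csmooth_real f)) * g + f * csmooth_Re (d (csmooth_real g)).
Proof.
rewrite rmorphM /= d_leibniz csmooth_ReD csmooth_Re_realM [d _ * _]mulrC.
by rewrite csmooth_Re_realM [g * _]mulrC.
Qed.

Lemma cderivation_Im_leibniz (f g : rsm) :
  csmooth_Im (d (csmooth_real (f * g))) =
  csmooth_Im (d (csmooth_real f)) * g + f * csmooth_Im (d (csmooth_real g)).
Proof.
rewrite rmorphM /= d_leibniz csmooth_ImD csmooth_Im_realM [d _ * _]mulrC.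
by rewrite csmooth_Im_realM [g * _]mulrC.
Qed.

(** On real functions, the real and imaginary parts of [d] are real vector fields. Their
    coefficients combine into u_j + i v_j, and C-linearity extends the formula to complex
    functions. *)
Lemma cderivation_frame (X : 'I_m -> vector_field M) : global_frame X ->
  exists c : 'I_m -> csm, forall f, d f = \sum_i c i * vf_complex (X i) f.
Proof.
move=> X_frame.
have [u uE] := vector_field_frame X_frame
  (VectorField cderivation_Re_linear cderivation_Re_leibniz).
have [v vE] := vector_field_frame X_frame
  (VectorField cderivation_Im_linear cderivation_Im_leibniz).
rewrite /= in uE vE.
exists (fun i => csmooth_of (u i) (v i)) => f.
have d_real w : d (csmooth_real w) =
    \sum_i csmooth_of (u i) (v i) * csmooth_real (X i w).
  rewrite [LHS]csmooth_ReIm uE vE !rmorph_sum mulr_sumr -big_split /=.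
  by apply: eq_bigr => i _; rewrite csmooth_ofE !rmorphM mulrDl mulrA.
rewrite {1}[f]csmooth_ReIm addrC d_linear !d_real mulr_sumr -big_split /=.
apply: eq_bigr => i _; rewrite /vf_complex (csmooth_ofE (X i _)) mulrDr addrC.
by rewrite mulrCA.
Qed.

End ComplexDerivations.

(** * Derivations of the matrix algebra *)

(** Matrix units of a single column suffice: entry (i, i0) of the hypothesis reads a_ik = 0 for i !=
    k, and a_kk = a_(i0,i0) for i = k. *)
Lemma comm_delta_mx_scalar (T : pzRingType) (n : nat) (a : 'M[T]_n) (i0 : 'I_n) :
  (forall k, a *m delta_mx k i0 = delta_mx k i0 *m a) -> a = (a i0 i0)%:M.
Proof.
move=> aC; apply/matrixP => i k; have /matrixP/(_ i i0) := aC k.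
rewrite !mxE (bigD1 k) //= big1 => [|j /negbTE jk]; last first.
  by rewrite !mxE jk mulr0.
rewrite !mxE !eqxx mulr1 addr0 => ->.
rewrite (bigD1 i0) //= big1 => [|j /negbTE jk]; last first.
  by rewrite !mxE jk andbF mul0r.
by rewrite !mxE !eqxx andbT addr0 mulr_natl.
Qed.

Section Derivations.
Variables (R : realType) (m : nat) (M : smoothManifold R m) (n : nat).
Local Notation csm := (csmoothFun M).
Local Notation A := (matalg M n).
Local Notation Der := (der M n).
Implicit Types (D : Der) (a b : A).

Lemma der_linear D c a b :
  D (csmooth_cst M c *: a + b) = csmooth_cst M c *: D a + D b.
Proof. by case: D => D /= /asboolP[+ _]; exact. Qed.

Lemma derM D a b : D (a * b) = D a * b + a * D b.
Proof. by case: D => D /= /asboolP[_ +]; exact. Qed.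

Lemma der_zmod D : zmod_morphism D.
Proof.
move=> a b; rewrite addrC -[- b]scaleN1r.
rewrite -(rmorph1 (@csmooth_cst R m M)) -rmorphN der_linear rmorphN rmorph1.
by rewrite scaleN1r addrC.
Qed.
HB.instance Definition _ D :=
  GRing.isZmodMorphism.Build _ _ (der_fun D) (der_zmod D).

Lemma derP D D' : D =1 D' -> D = D'.
Proof. by move=> DD; apply: val_inj; apply/funext. Qed.

Lemma der_sumE (I : finType) (f : I -> csm) (D : I -> Der) a :
  (\sum_i f i *: D i) a = \sum_i f i *: D i a.
Proof. by elim/big_rec2: _ => // i x y _ <-. Qed.

Variable E : 'I_(n ^ 2 - 1) -> 'M[R[i]]_n.
Hypothesis E_basis : traceless_basis E.

(** Subtracting the scalar [z], the trace of E_kl divided by [n], leaves a traceless matrix and does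
    not change commutators. *)
Lemma delta_inner_der_span (n_gt0 : (0 < n)%N) (k l : 'I_n) :
  exists c : 'I_(n ^ 2 - 1) -> R[i], forall a : A,
    delta_mx k l * a - a * delta_mx k l =
    \sum_h csmooth_cst M (c h) *: inner_der M (E h) a.
Proof.
have [_ _ E_span] := E_basis.
pose z : R[i] := (k == l)%:R / n%:R.
have [|c cE] := E_span (delta_mx k l - z%:M).
  rewrite raddfB /= mxtrace_scalar -mulr_natr divfK ?pnatr_eq0 -?lt0n //.
  rewrite /mxtrace (bigD1 k) //= big1 => [|j /negbTE jk]; last by rewrite mxE jk.
  by rewrite mxE eqxx addr0 subrr.
exists c => a; pose Z : A := (csmooth_cst M z)%:M.
have -> : delta_mx k l =
    \sum_h csmooth_cst M (c h) *: cst_mx M (E h) + Z :> A.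
  rewrite -(map_delta_mx (@csmooth_cst R m M)) -[delta_mx k l](subrK z%:M) cE.
  rewrite map_mxD map_scalar_mx map_mx_sum; congr (_ + _).
  by apply: eq_bigr => h _; rewrite map_mxZ.
have Zc : a * Z = Z * a by exact: scalar_mxC.
rewrite mulrDl mulrDr opprD addrACA Zc subrr addr0.
rewrite mulr_suml mulr_sumr -sumrB; apply: eq_bigr => h _.
by rewrite -!mulmxE -scalemxAl -scalemxAr -scalerBr.
Qed.

(** The commutator with [B] is C^oo(M)-linear in [B], so expanding [B] in matrix units reduces to
    constant matrices. *)
Lemma inner_der_span (n_gt0 : (0 < n)%N) (B : A) :
  exists b : 'I_(n ^ 2 - 1) -> csm, forall a : A,
    (\sum_h b h *: inner_der M (E h)) a = B * a - a * B.
Proof.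
have [c cE] := choice (fun kl => delta_inner_der_span n_gt0 kl.1 kl.2).
exists (fun h => \sum_kl B kl.1 kl.2 * csmooth_cst M (c kl h)) => a.
rewrite der_sumE; under eq_bigr do rewrite scaler_suml.
have BE : B = \sum_kl B kl.1 kl.2 *: delta_mx kl.1 kl.2.
  by rewrite {1}[B]matrix_sum_delta pair_bigA.
rewrite exchange_big /= [in RHS]BE.
rewrite mulr_suml mulr_sumr -sumrB; apply: eq_bigr => kl _.
rewrite -!mulmxE -scalemxAl -scalemxAr -scalerBr cE scaler_sumr.
by apply: eq_bigr => h _; rewrite scalerA.
Qed.

(** Applying [D] to f E_kl = E_kl f shows that D(f 1) commutes with matrix units, so it is a scalar
    matrix d(f) 1; then D(a) is the sum of the d(a_kl) E_kl. *)
Lemma der_entrywise (i0 : 'I_n) D : (forall k l, D (delta_mx k l) = 0) ->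
  exists d : csm -> csm,
    [/\ forall c f g, d (csmooth_cst M c * f + g) = csmooth_cst M c * d f + d g,
        forall f g, d (f * g) = d f * g + f * d g
      & forall a, D a = map_mx d a].
Proof.
move=> Dd; pose d f := D f%:M i0 i0.
have dE f : D f%:M = (d f)%:M.
  apply: comm_delta_mx_scalar => k.
  transitivity (D (f%:M * delta_mx k i0)); first by rewrite derM Dd mulr0 addr0.
  by rewrite -mulmxE -scalar_mxC mulmxE derM Dd mul0r add0r.
exists d; split => [c f g|f g|a].
- by rewrite /d raddfD /= -scale_scalar_mx der_linear !mxE.
- rewrite -[LHS]/(D (f * g)%:M i0 i0) scalar_mxM mulmxE derM !dE -!mulmxE.
  by rewrite -!scalar_mxM -raddfD mxE eqxx.
- rewrite {1}[a]matrix_sum_delta raddf_sum /= [RHS]matrix_sum_delta.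
  apply: eq_bigr => i _; rewrite raddf_sum /=; apply: eq_bigr => j _.
  by rewrite -!mul_scalar_mx !mulmxE derM Dd mulr0 addr0 dE mxE.
Qed.

(* With B = sum_i D(E_i1) E_1i one has [B, E_kl] = D(E_kl), so D - ad B kills
   the matrix units and is therefore entrywise. *)
Lemma der_frame_span (n_gt0 : (0 < n)%N) (X : 'I_m -> vector_field M) D :
  global_frame X ->
  exists f : 'I_(m + (n ^ 2 - 1)) -> csm, D = \sum_j f j *: der_frame X E j.
Proof.
move=> X_frame; pose i0 := Ordinal n_gt0.
pose B : A := \sum_i D (delta_mx i i0) * delta_mx i0 i.
have [b bE] := inner_der_span n_gt0 B.
pose D' : Der := D - \sum_h b h *: inner_der M (E h).
have D'E a : D' a = D a - (B * a - a * B) by rewrite -bE.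
have D'0 k l : D' (delta_mx k l) = 0.
  rewrite D'E; have -> : B * delta_mx k l = D (delta_mx k i0) * delta_mx i0 l.
    rewrite mulr_suml (bigD1 k) //= big1 => [|i /negbTE ik].
      by rewrite addr0 -mulrA -mulmxE mul_delta_mx.
    by rewrite -mulrA -!mulmxE mul_delta_mx_cond ik mulr0n mulmx0.
  (* By Leibniz, E_kl D(E_i1) = D(E_kl E_i1) - D(E_kl) E_i1. After multiplication by E_1i and
     summation, only i = l survives in the first term, and the E_ii sum to 1 in the second. *)
  have -> : delta_mx k l * B =
      D (delta_mx k i0) * delta_mx i0 l - D (delta_mx k l).
    rewrite mulr_sumr.
    under eq_bigr => i _.
      rewrite mulrA (_ : delta_mx k l * D (delta_mx i i0) =
        D (delta_mx k l * delta_mx i i0) - D (delta_mx k l) * delta_mx i i0);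
        last by rewrite derM addrC addKr.
      rewrite mulrBl -[_ * delta_mx i i0 * _]mulrA -!mulmxE mul_delta_mx.
      rewrite mul_delta_mx_cond.
      over.
    rewrite sumrB -mulmx_sumr; congr (_ - _).
      rewrite (bigD1 l) //= big1 => [|i /negbTE il].
        by rewrite eqxx mulr1n addr0.
      by rewrite eq_sym il mulr0n raddf0 mul0mx.
    rewrite (_ : \sum_i delta_mx i i = 1%:M) ?mulmx1 //.
    by rewrite scalar_mx_sum_delta; apply: eq_bigr => i _; rewrite scale1r.
  by rewrite subKr subrr.
have [d [d_lin d_leib D'd]] := der_entrywise i0 D'0.
have [c cE] := cderivation_frame d_lin d_leib X_frame.
exists (fun j => match fintype.split j with inl i => c i | inr h => b h end).
rewrite big_split_ord /=.
under [X in _ + X]eq_bigr => h _ do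
  rewrite /der_frame (unsplitK (inr h : 'I_m + 'I_(n ^ 2 - 1))).
rewrite -[LHS](subrK (\sum_h b h *: inner_der M (E h))); congr (_ + _).
apply: derP => a; rewrite der_sumE D'd; apply/matrixP => k l.
rewrite mxE cE summxE; apply: eq_bigr => i _.
by rewrite /der_frame (unsplitK (inl i : 'I_m + 'I_(n ^ 2 - 1))) !mxE.
Qed.

End Derivations.

(** * Forms and tensors in a dual frame *)

Section Frame.
Variables (R : realType) (m : nat) (M : smoothManifold R m) (n : nat).
Local Notation A := (matalg M n).
Local Notation Der := (der M n).
Local Notation A1 := (oneform M n).
Local Notation A2 := (oneform2 M n).
Implicit Types (a b : A) (alpha beta zeta : A1) (s t : A2) (X Y : Der).

Lemma form_linear alpha f X Y : alpha (f *: X + Y) = f *: alpha X + alpha Y.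
Proof. by case: alpha => al /= /asboolP. Qed.

Lemma form_comb alpha (I : finType) (f : I -> csmoothFun M) (X : I -> Der) :
  alpha (\sum_i f i *: X i) = \sum_i f i *: alpha (X i).
Proof.
elim/big_rec2: _ => [|i x y _ <-]; last by rewrite form_linear.
have := form_linear alpha 1 0 0; rewrite !scale1r addr0 => e0.
by apply: (addIr (alpha 0)); rewrite -e0 add0r.
Qed.

Lemma form_sumE (I : finType) (alpha : I -> A1) X :
  (\sum_i alpha i) X = \sum_i alpha i X.
Proof. by elim/big_rec2: _ => // i x y _ <-. Qed.

Lemma ftensDl alpha alpha' beta :
  ftens (alpha + alpha') beta = ftens alpha beta + ftens alpha' beta.
Proof. exact: tensDl. Qed.

Lemma ftensDr alpha beta beta' :
  ftens alpha (beta + beta') = ftens alpha beta + ftens alpha beta'.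
Proof. exact: tensDr. Qed.

Lemma ftens_balanced alpha a beta :
  ftens (ractf alpha a) beta = ftens alpha (lactf a beta).
Proof. exact: tens_balanced. Qed.

Lemma ftens0l beta : ftens 0 beta = 0.
Proof. by apply: (addIr (ftens 0 beta)); rewrite -ftensDl !add0r. Qed.

Lemma ftens0r alpha : ftens alpha 0 = 0.
Proof. by apply: (addIr (ftens alpha 0)); rewrite -ftensDr !add0r. Qed.

Lemma ftens_suml (I : finType) (alpha : I -> A1) beta :
  ftens (\sum_i alpha i) beta = \sum_i ftens (alpha i) beta.
Proof.
exact: (big_morph (fun x => ftens x beta) (fun x y => ftensDl x y beta)
  (ftens0l beta)).
Qed.

Lemma ftens_sumr (I : finType) alpha (beta : I -> A1) :
  ftens alpha (\sum_i beta i) = \sum_i ftens alpha (beta i).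
Proof. exact: (big_morph (ftens alpha) (ftensDr alpha) (ftens0r alpha)). Qed.

(** A representative list writes [t] as a finite sum of simple tensors. *)
Lemma oneform2_ind (P : A2 -> Prop) : P 0 ->
  (forall alpha beta t, P t -> P (ftens alpha beta + t)) -> forall t, P t.
Proof.
move=> P0 PD t; rewrite -[t]tens_reprK tens_class_sum.
elim: (generic_quotient.repr t) => [|p r IH]; first by rewrite big_nil.
by rewrite big_cons; exact: PD.
Qed.

Lemma eval20 X Y : eval2 (0 : A2) X Y = 0.
Proof. by apply: (addIr (eval2 0 X Y)); rewrite -eval2D !add0r. Qed.

Lemma eval2_sum (I : finType) (t : I -> A2) X Y :
  eval2 (\sum_i t i) X Y = \sum_i eval2 (t i) X Y.
Proof. exact: (big_morph (fun t => eval2 t X Y) (eval2D X Y) (eval20 X Y)). Qed.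

Lemma eval2_lact2 a t X Y : eval2 (lact2 a t) X Y = a * eval2 t X Y.
Proof.
elim/oneform2_ind: t => [|alpha beta t IH].
  have -> : lact2 a 0 = 0 :> A2.
    by apply: (addIr (lact2 a 0)); rewrite -lact2D !add0r.
  by rewrite eval20 mulr0.
by rewrite lact2D !eval2D IH lact2E !eval2E mulrDr mulrA.
Qed.

Lemma eval2_ract2 t a X Y : eval2 (ract2 t a) X Y = eval2 t X Y * a.
Proof.
elim/oneform2_ind: t => [|alpha beta t IH].
  have -> : ract2 0 a = 0 :> A2.
    by apply: (addIr (ract2 0 a)); rewrite -ract2D !add0r.
  by rewrite eval20 mul0r.
by rewrite ract2D !eval2D IH ract2E !eval2E mulrDl -mulrA.
Qed.

Variables (N : nat) (e : 'I_N -> Der) (theta : 'I_N -> A1).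
Hypothesis e_span : forall X, exists f : 'I_N -> csmoothFun M,
  X = \sum_j f j *: e j.
Hypothesis theta_dual : dual_family e theta.

Lemma form_frameP alpha beta : (forall j, alpha (e j) = beta (e j)) ->
  alpha = beta.
Proof.
move=> ab; apply: formP => X; have [f ->] := e_span X.
by rewrite !form_comb; apply: eq_bigr => j _; rewrite ab.
Qed.

(** On the frame [theta i] takes only the values 0 and 1, which commute with every [a]. *)
Lemma dual_form_central i : central_form (theta i).
Proof.
move=> a; apply: form_frameP => j /=.
by rewrite theta_dual mulr_natr mulr_natl.
Qed.

Lemma sum_dual_l (c : 'I_N -> A) k : \sum_i theta k (e i) * c i = c k.
Proof.
rewrite (bigD1 k) //= big1 => [|i /negbTE ik].
  by rewrite theta_dual eqxx mul1r addr0.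
by rewrite theta_dual eq_sym ik mul0r.
Qed.

Lemma sum_dual_r (c : 'I_N -> A) k : \sum_i c i * theta i (e k) = c k.
Proof.
rewrite (bigD1 k) //= big1 => [|i /negbTE ik].
  by rewrite theta_dual eqxx mulr1 addr0.
by rewrite theta_dual ik mulr0.
Qed.

Lemma form_frame_l zeta : zeta = \sum_i lactf (zeta (e i)) (theta i).
Proof. by apply: form_frameP => k; rewrite form_sumE sum_dual_r. Qed.

Lemma form_frame_r zeta : zeta = \sum_i ractf (theta i) (zeta (e i)).
Proof.
by rewrite {1}[zeta]form_frame_l; apply: eq_bigr => i _; exact: dual_form_central.
Qed.

Lemma ractf0 alpha : ractf alpha 0 = 0.
Proof. by apply: formP => X; exact: mulr0. Qed.

Lemma ractf_addr alpha a b : ractf alpha (a + b) = ractf alpha a + ractf alpha b.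
Proof. by apply: formP => X; exact: mulrDr. Qed.

(** For a simple tensor, expand alpha = theta^j alpha(e_j), move alpha(e_j) across the tensor sign,
    then expand alpha(e_j) beta in the same way. *)
Lemma oneform2_frame t : t =
  \sum_j \sum_k ftens (theta j) (ractf (theta k) (eval2 t (e j) (e k))).
Proof.
elim/oneform2_ind: t => [|alpha beta t {1}->].
  rewrite big1 // => j _; rewrite big1 // => k _.
  by rewrite eval20 ractf0 ftens0r.
rewrite {1}[alpha]form_frame_r ftens_suml -big_split /=.
apply: eq_bigr => j _; rewrite ftens_balanced.
rewrite {1}[lactf _ beta]form_frame_r ftens_sumr -big_split /=.
by apply: eq_bigr => k _; rewrite eval2D eval2E ractf_addr ftensDr.
Qed.

(** Equality in the quotient defining the tensor product thus becomes equality of matrices. *)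
Lemma eval2_inj s t :
  (forall j k, eval2 s (e j) (e k) = eval2 t (e j) (e k)) -> s = t.
Proof.
move=> st; rewrite [s]oneform2_frame [t]oneform2_frame.
by apply: eq_bigr => j _; apply: eq_bigr => k _; rewrite st.
Qed.

Lemma eval2_frame (G : 'I_N -> 'I_N -> A) j k :
  eval2 (\sum_j \sum_k ftens (theta j) (ractf (theta k) (G j k))) (e j) (e k) =
  G j k.
Proof.
rewrite eval2_sum.
rewrite -[RHS](sum_dual_l (G ^~ k)); apply: eq_bigr => j' _.
rewrite eval2_sum -[G j' k](sum_dual_l (G j')) mulr_sumr.
apply: eq_bigr => k' _; rewrite eval2E /=.
by rewrite !theta_dual ![_ == j']eq_sym ![_ == k']eq_sym.
Qed.

Lemma complex_linearD (nabla : A1 -> A2) : complex_linear nabla ->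
  {morph nabla : zeta xi / zeta + xi}.
Proof.
move=> lin zeta xi; have := lin 1 zeta xi.
have -> : lactf (csmooth_cst M 1)%:M zeta = zeta.
  by apply: formP => X /=; rewrite rmorph1 mul1r.
(* That 1 acts as the identity on tensors is checked on frame values. *)
move=> ->; congr (_ + _); apply: eval2_inj => j k.
by rewrite eval2_lact2 rmorph1 mul1r.
Qed.

Lemma complex_linear_sum (nabla : A1 -> A2) (I : finType) (zeta : I -> A1) :
  complex_linear nabla -> nabla (\sum_i zeta i) = \sum_i nabla (zeta i).
Proof.
move=> /complex_linearD nablaD; apply: big_morph => //.
by apply: (addIr (nabla 0)); rewrite -nablaD !add0r.
Qed.

(** * Connections in the frame *)

Variables (nablaL nablaR : A1 -> A2).
Hypothesis nablaL_conn : left_connection nablaL.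
Hypothesis nablaR_conn : right_connection nablaR.
Variables (Gamma Gammat : 'I_N -> 'I_N -> 'I_N -> A).
Hypothesis GammaE : forall i, nablaL (theta i) =
  \sum_j \sum_k ftens (theta j) (ractf (theta k) (Gamma i j k)).
Hypothesis GammatE : forall i, nablaR (theta i) =
  \sum_j \sum_k ftens (theta j) (ractf (theta k) (Gammat i j k)).

(** Coefficients are put on the left of the theta^i, where the left Leibniz rule applies. *)
Lemma eval2_left_connection zeta j k :
  eval2 (nablaL zeta) (e j) (e k) =
  e j (zeta (e k)) + \sum_i zeta (e i) * Gamma i j k.
Proof.
have [linL leibL] := nablaL_conn.
rewrite {1}[zeta]form_frame_l complex_linear_sum // eval2_sum.
rewrite -[e j _](sum_dual_r (fun i => e j (zeta (e i)))) -big_split /=.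
apply: eq_bigr => i _; rewrite leibL eval2D eval2E eval2_lact2.
by rewrite GammaE eval2_frame.
Qed.

(** Here coefficients stand on the right. The derivative falls in the second tensor factor, so
    evaluation at the swapped pair gives the same term e_j(zeta_k) as for the left connection. *)
Lemma eval2_right_connection zeta j k :
  eval2 (nablaR zeta) (e k) (e j) =
  e j (zeta (e k)) + \sum_i Gammat i k j * zeta (e i).
Proof.
have [linR leibR] := nablaR_conn.
rewrite {1}[zeta]form_frame_r complex_linear_sum // eval2_sum.
rewrite -[e j _](sum_dual_r (fun i => e j (zeta (e i)))) -big_split /=.
apply: eq_bigr => i _; rewrite leibR eval2D eval2E eval2_ract2.
by rewrite GammatE eval2_frame addrC theta_dual mulr_natr mulr_natl.
Qed.

Variable sigma : A2 -> A2.
Hypothesis sigma_flip : is_flip sigma.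

Lemma connection_flipP zeta : nablaL zeta = sigma (nablaR zeta) <->
  forall j k, \sum_i zeta (e i) * Gamma i j k = \sum_i Gammat i k j * zeta (e i).
Proof.
have [_ flipE] := sigma_flip; split => [LR j k|LR].
  apply: (addrI (e j (zeta (e k)))).
  by rewrite -eval2_left_connection -eval2_right_connection LR flipE.
apply: eval2_inj => j k.
by rewrite flipE eval2_left_connection eval2_right_connection LR.
Qed.

Lemma connection_flip_dual a i j k :
  nablaL (lactf a (theta i)) = sigma (nablaR (lactf a (theta i))) ->
  a * Gamma i j k = Gammat i k j * a.
Proof.
move=> /connection_flipP/(_ j k).
(* Writing a theta^i as theta^i a puts the Kronecker delta in front, so that both sums collapse. *)
rewrite dual_form_central /=.
under eq_bigr do rewrite -mulrA.
rewrite (sum_dual_l (fun i' => a * Gamma i' j k)) => ->.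
rewrite (bigD1 i) //= big1 ?addr0 => [|i' /negbTE ii'].
  by rewrite theta_dual eqxx mul1r.
by rewrite theta_dual eq_sym ii' mul0r mulr0.
Qed.

End Frame.

(** * The centre of the algebra and the two equivalences *)

Lemma in_CinftyP (R : realType) (m n : nat) (M : smoothManifold R m)
    (a : matalg M n) : (0 < n)%N ->
  in_Cinfty a <-> forall b, b * a = a * b.
Proof.
move=> n_gt0; split => [[f ->] b|aC]; first exact: scalar_mxC.
pose i0 := Ordinal n_gt0; exists (a i0 i0).
by apply: comm_delta_mx_scalar => k; rewrite !mulmxE aC.
Qed.

Theorem proposition2p2 (R : realType) (m n : nat) (M : smoothManifold R m)
    (n_gt0 : (0 < n)%N)
    (X : 'I_m -> vector_field M) (X_frame : global_frame X)
    (E : 'I_(n ^ 2 - 1) -> 'M[R[i]]_n) (E_basis : traceless_basis E)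
    (theta : 'I_(m + (n ^ 2 - 1)) -> oneform M n)
    (theta_dual : dual_family (der_frame X E) theta)
    (sigma : oneform2 M n -> oneform2 M n) (sigma_flip : is_flip sigma)
    (nablaL nablaR : oneform M n -> oneform2 M n)
    (nablaL_conn : left_connection nablaL)
    (nablaR_conn : right_connection nablaR)
    (Gamma Gammat : 'I_(m + (n ^ 2 - 1)) -> 'I_(m + (n ^ 2 - 1)) ->
                    'I_(m + (n ^ 2 - 1)) -> matalg M n)
    (GammaE : forall i, nablaL (theta i) =
       \sum_j \sum_k ftens (theta j) (ractf (theta k) (Gamma i j k)))
    (GammatE : forall i, nablaR (theta i) =
       \sum_j \sum_k ftens (theta j) (ractf (theta k) (Gammat i j k))) :
  (sigma_compatible sigma nablaL nablaR <->
     forall i j k, Gammat i k j = Gamma i j k) /\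
  (sigma_compatible_everywhere sigma nablaL nablaR <->
     forall i j k, Gammat i k j = Gamma i j k /\ in_Cinfty (Gamma i j k)).
Proof.
have e_span D := der_frame_span E_basis n_gt0 D X_frame.
have flipP := connection_flipP e_span theta_dual nablaL_conn nablaR_conn
  GammaE GammatE sigma_flip.
have flip_dual := connection_flip_dual e_span theta_dual nablaL_conn nablaR_conn
  GammaE GammatE sigma_flip.
have lact1 zeta : lactf 1 zeta = zeta by apply: formP => Y; exact: mul1r.
split; split.
(* The test form is theta^i itself, which is central. *)
- move=> LR i j k; have := flip_dual 1 i j k; rewrite lact1 mul1r mulr1 => -> //.
  by apply: LR; exact: dual_form_central e_span theta_dual i.
- move=> GG zeta zetaC; apply/flipP => j k; apply: eq_bigr => i _.
  (* Centrality of [zeta], evaluated at e_i, makes zeta_i commute with the Christoffel symbol. *)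
  rewrite GG; have := esym (zetaC (Gamma i j k)).
  by move/(congr1 (fun xi : oneform M n => xi (der_frame X E i))).
- move=> LR i j k.
  have GG : Gammat i k j = Gamma i j k.
    by have := flip_dual 1 i j k (LR _); rewrite mul1r mulr1.
  (* Testing on a theta^i with arbitrary [a] shows that the symbol commutes with all of A. *)
  split => //; apply/in_CinftyP => // a.
  by rewrite (flip_dual a i j k (LR _)) GG.
- move=> GG zeta; apply/flipP => j k; apply: eq_bigr => i _.
  have [-> /in_CinftyP-> //] := GG i j k.
Qed.
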